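(* Let $P\subset\mathbb{R}^d$ be a full-dimensional centrally symmetric polytope. For any facets $F,G$ of $P$ we have $$\mathcal{B}_{G,F}=-\mathcal{B}_{F,G}=\mathcal{B}_{-F,-G}.$$
   Context: $P=-P$ is a full-dimensional convex polytope in $\mathbb{R}^d$. Its distance function is $\operatorname{dist}(a,b)=\min\{\alpha\ge 0 : b-a\in\alpha P\}$. For $a,b\in\mathbb{R}^d$ the bisector is $\operatorname{bis}(a,b)=\{x\in\mathbb{R}^d:\operatorname{dist}(a,x)=\operatorname{dist}(b,x)\}$. For a facet $F$ of $P$, $C_F=\operatorname{cone}(F)$ is the set of all finite nonnegative linear combinations of points of $F$. For facets $F,G$, $\operatorname{bis}_{F,G}(a,b)=\operatorname{bis}(a,b)\cap(C_F+a)\cap(C_G+b)$. The bisection cone is $\mathcal{B}_{F,G}=\{x\in\mathbb{R}^d:\operatorname{bis}_{F,G}(0,x)\neq\emptyset\}$. *)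

(* Defs.v *)
From HB Require Import structures.
From mathcomp Require Import all_boot all_order all_algebra.
From mathcomp Require Import boolp classical_sets reals.

Set Implicit Arguments.
Unset Strict Implicit.
Unset Printing Implicit Defensive.

Import Order.TTheory GRing.Theory Num.Theory.
Local Open Scope classical_set_scope.
Local Open Scope ring_scope.

Section ConvexGeometry.
Context {R : realType} {d : nat}.
Local Notation V := 'rV[R]_d.
Implicit Types (A P F G : set V) (a b x : V).

Definition translate A a : set V := [set y + a | y in A].
Definition dilate (t : R) A : set V := [set t *: y | y in A].
Definition oppset A : set V := [set - y | y in A].

Definition conv_hull A : set V := [set x | exists n (c : 'I_n -> R) (v : 'I_n -> V),
  [/\ forall i, 0 <= c i, \sum_i c i = 1, forall i, A (v i)
    & x = \sum_i c i *: v i]].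

Definition aff_hull A : set V := [set x | exists n (c : 'I_n -> R) (v : 'I_n -> V),
  [/\ \sum_i c i = 1, forall i, A (v i) & x = \sum_i c i *: v i]].

(* The empty combination is allowed, so 0 always belongs to [cone A]. *)
Definition cone A : set V := [set x | exists n (c : 'I_n -> R) (v : 'I_n -> V),
  [/\ forall i, 0 <= c i, forall i, A (v i) & x = \sum_i c i *: v i]].

(* [A] has dimension [n]: its affine hull is a translate of an [n]-dimensional
   linear subspace; the empty set has dimension -1. *)
Definition has_dim A (n : int) : Prop :=
  (A = set0 /\ n = -1) \/
  (exists x (U : {vspace V}),
     aff_hull A = [set x + u | u in [set u | u \in U]] /\ n = (\dim U)%:Z).

Definition polytope P : Prop := exists s : seq V, P = conv_hull [set v | v \in s].

Definition full_dimensional P : Prop := has_dim P d%:Z.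

Definition centrally_symmetric P : Prop := P = oppset P.

(* The points of [P] where a valid linear inequality is tight; the trivial
   inequalities make the empty set and [P] itself faces. *)
Definition face P F : Prop := exists (c : V) (c0 : R),
  (forall x, P x -> \sum_i c 0 i * x 0 i <= c0) /\
  F = [set x | P x /\ \sum_i c 0 i * x 0 i = c0].

Definition facet P F : Prop :=
  face P F /\ exists n : int, has_dim P n /\ has_dim F (n - 1).

(* The least element of a set of reals; 0 if there is none. *)
Definition set_min (S : set R) : R := xget 0 [set m | S m /\ lbound S m].

(* The minimum is attained when [P] is a full-dimensional polytope with
   [P = - P]: [P] is then compact with 0 in its interior. *)
Definition dist P a b : R := set_min [set t | 0 <= t /\ dilate t P (b - a)].

Definition bis P a b : set V := [set x | dist P a x = dist P b x].

Definition facet_bis P F G a b : set V :=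
  bis P a b `&` translate (cone F) a `&` translate (cone G) b.

Definition bisection_cone P F G : set V := [set x | facet_bis P F G 0 x !=set0].

End ConvexGeometry.

(* Main.v *)
Require Import Defs.
From HB Require Import structures.
From mathcomp Require Import all_boot all_order all_algebra.
From mathcomp Require Import boolp classical_sets reals.

(** Both equalities are point symmetries of the bisector configuration: if [p]
    witnesses [x] in the cone of [(F, G)], then [p - x] witnesses [- x] in the
    cone of [(G, F)], since [dist] is translation invariant, and [- p] witnesses
    [- x] in the cone of [(- F, - G)], since [P = - P]. *)

Import GRing.Theory.
Local Open Scope classical_set_scope.
Local Open Scope ring_scope.

Lemma oppset_oppset (R : realType) (d : nat) (A : set 'rV[R]_d) :
  oppset (oppset A) = A.
Proof.
rewrite /oppset image_comp -[RHS]image_id.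
by apply: eq_imagel => x _ /=; rewrite opprK.
Qed.

Lemma oppsetE (R : realType) (d : nat) (A : set 'rV[R]_d) (x : 'rV[R]_d) :
  oppset A x = A (- x).
Proof.
apply/propext; split=> [[y Ay <-]|Ax]; first by rewrite opprK.
by exists (- x) => //; rewrite opprK.
Qed.

Lemma translateE (R : realType) (d : nat) (A : set 'rV[R]_d) (a x : 'rV[R]_d) :
  translate A a x = A (x - a).
Proof.
apply/propext; split=> [[y Ay <-]|Ax]; first by rewrite addrK.
by exists (x - a) => //; rewrite subrK.
Qed.

Lemma dilate_oppset (R : realType) (d : nat) (t : R) (A : set 'rV[R]_d) :
  dilate t (oppset A) = oppset (dilate t A).
Proof.
rewrite /dilate /oppset !image_comp.
by apply: eq_imagel => x _ /=; rewrite scalerN.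
Qed.

(** The same nonnegative coefficients serve on both sides; only the generators change sign. *)
Lemma cone_oppset (R : realType) (d : nat) (A : set 'rV[R]_d) :
  cone (oppset A) = oppset (cone A).
Proof.
apply/seteqP; split=> x; rewrite oppsetE => -[n [c [v [c0 Av xE]]]];
  exists n, c, (fun i => - v i); split=> // [i|].
- by rewrite -oppsetE.
- by rewrite xE -sumrN; apply: eq_bigr => i _; rewrite scalerN.
- by rewrite oppsetE opprK.
- by rewrite -[x]opprK xE -sumrN; apply: eq_bigr => i _; rewrite scalerN.
Qed.

Lemma dist_subr (R : realType) (d : nat) (P : set 'rV[R]_d)
    (a b c : 'rV[R]_d) :
  dist P (a - c) (b - c) = dist P a b.
Proof. by rewrite /dist opprB addrA subrK. Qed.

(** Every dilate of [P] is symmetric about 0, so [b - a] and its opposite admit the same scalars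
    [t]; the two sets under [set_min] coincide, attained minimum or not. *)
Lemma dist_opp (R : realType) (d : nat) (P : set 'rV[R]_d) (a b : 'rV[R]_d) :
  centrally_symmetric P -> dist P (- a) (- b) = dist P a b.
Proof.
move=> symP; rewrite /dist; congr set_min; apply/seteqP.
by split=> t /= [t0 Pt]; split=> //; move: Pt;
  rewrite {1}symP dilate_oppset oppsetE !opprD !opprK.
Qed.

Lemma bisection_cone_swap (R : realType) (d : nat) (P F G : set 'rV[R]_d)
    (x : 'rV[R]_d) :
  bisection_cone P F G x -> bisection_cone P G F (- x).
Proof.
case=> p [[]]; rewrite /bis /= !translateE subr0 => distp Fp Gp.
(* Translation by [- x] sends the pair of centres [(0, x)] to [(- x, 0)]: the cone of [G] gets apex
   0 and that of [F] apex [- x], hence the exchange of facets. *)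
exists (p - x); split; first split; rewrite ?translateE ?subr0 //.
  by rewrite /bis /= -(subrr x) dist_subr -distp -(dist_subr _ _ _ _ _ x) sub0r.
by rewrite opprK subrK.
Qed.

Lemma bisection_cone_opp (R : realType) (d : nat) (P F G : set 'rV[R]_d)
    (x : 'rV[R]_d) :
  centrally_symmetric P -> bisection_cone P F G x ->
  bisection_cone P (oppset F) (oppset G) (- x).
Proof.
move=> symP [p [[]]]; rewrite /bis /= !translateE => distp Fp Gp.
exists (- p); split; first split;
  rewrite ?translateE ?cone_oppset ?oppsetE ?opprB ?opprK.
(* The centre 0 is fixed by the reflection, so [F] and [G] keep their order; writing it as [- 0]
   makes [dist_opp] apply to both distances. *)
- by rewrite /bis /= -{1}oppr0 !dist_opp.
- by move: Fp; rewrite subr0 add0r.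
- by rewrite addrC.
Qed.

Theorem corollary3p3 (R : realType) (d : nat) (P F G : set 'rV[R]_d)
    (polyP : polytope P) (fullP : full_dimensional P)
    (symP : centrally_symmetric P) (facF : facet P F) (facG : facet P G) :
  bisection_cone P G F = oppset (bisection_cone P F G) /\
  oppset (bisection_cone P F G) = bisection_cone P (oppset F) (oppset G).
Proof.
(* Both symmetries are involutions, so one implication for each yields both inclusions. *)
split; apply/seteqP; split=> x; rewrite oppsetE.
- exact: bisection_cone_swap.
- by move=> /bisection_cone_swap; rewrite opprK.
- by move=> /(bisection_cone_opp _ _ _ _ _ _ symP); rewrite opprK.
- by move=> /(bisection_cone_opp _ _ _ _ _ _ symP); rewrite !oppset_oppset.
Qed.
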